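(* Every commutative Kasch ring is strongly dual Kasch.
   Context: Rings are associative, unital and non-trivial; modules are unital. A commutative ring $R$ is Kasch if every simple $R$-module embeds into $R$. A commutative ring $R$ is strongly dual Kasch if every simple $R$-module $S$ is a homomorphic image of its injective hull $E(S)$. *)

(* Defs.v *)
From HB Require Import structures.
From mathcomp Require Import all_boot all_order all_algebra.
Set Implicit Arguments.
Unset Strict Implicit.
Unset Printing Implicit Defensive.

Import GRing.Theory.
Local Open Scope ring_scope.

(* Submodules are boolean predicates closed under the module operations
   (submod_closed). Logic is meant to be classical, so these are all the
   submodules. *)

Definition simple_module (R : comNzRingType) (S : lmodType R) : Prop :=
  (exists x : S, x != 0) /\
  (forall P : {pred S}, submod_closed P -> P =i pred1 0 \/ P =i predT).

Definition injective_module (R : comNzRingType) (E : lmodType R) : Prop :=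
  forall (A B : lmodType R) (f : {linear A -> B}) (g : {linear A -> E}),
    injective f -> exists h : {linear B -> E}, forall a : A, h (f a) = g a.

Definition essential_embedding (R : comNzRingType) (M E : lmodType R)
    (i : {linear M -> E}) : Prop :=
  injective i /\
  (forall P : {pred E}, submod_closed P ->
     (exists2 x : E, x \in P & x != 0) ->
     exists2 m : M, i m \in P & i m != 0).

Definition is_injective_hull (R : comNzRingType) (M E : lmodType R)
    (i : {linear M -> E}) : Prop :=
  injective_module E /\ essential_embedding i.

Definition kasch (R : comNzRingType) : Prop :=
  forall S : lmodType R, simple_module S ->
    exists f : {linear S -> R^o}, injective f.

(* E(S) is determined up to isomorphism over S, so the condition is imposed on
   every injective hull of S. *)
Definition strongly_dual_kasch (R : comNzRingType) : Prop :=
  forall S : lmodType R, simple_module S ->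
    forall (E : lmodType R) (i : {linear S -> E}), is_injective_hull i ->
      exists p : {linear E -> S}, forall s : S, exists e : E, p e = s.

(* Main.v *)
Require Import Defs.
From HB Require Import structures.
From mathcomp Require Import all_boot all_order all_algebra.
From mathcomp Require Import boolp.

Set Implicit Arguments.
Unset Strict Implicit.
Unset Printing Implicit Defensive.

Import GRing.Theory.
Local Open Scope ring_scope.

(** Let [S] be a simple module with injective hull [i : S -> E]. The Kasch
    property embeds [S] into [R]; let [a] in [R] be the image of a nonzero
    [s0] in [S]. The surjection [E -> S] is multiplication by [a], and it
    works for two reasons.

    Multiplication by [a] does not kill [E]: as [E] is injective, [i] extends
    along the embedding of [S] into [R] to a map [R -> E], and if this map
    sends [1] to [e] then [a *: e = i s0 != 0].

    Multiplication by [a] sends [E] into [i S] ([scale_in_hull]): the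
    annihilator of [a] is the maximal ideal [ann s0], so every nonzero [a *: x]
    spans a simple submodule of [E], which must lie in the essential submodule
    [i S].

    So multiplication by [a] corestricts to a map [E -> S] that reaches [s0],
    and [s0] generates [S]. *)

Lemma submod_closed_cyclic (R : comNzRingType) (M : lmodType R) (x : M) :
  submod_closed [pred y | `[< exists r : R, y = r *: x >]].
Proof.
split=> [|c u v].
  by rewrite inE; apply/asboolP; exists 0; rewrite scale0r.
rewrite !inE => /asboolP[r ->] /asboolP[q ->].
by apply/asboolP; exists (c * r + q); rewrite scalerDl scalerA.
Qed.

Lemma simple_module_cyclic (R : comNzRingType) (S : lmodType R) (t : S) :
  simple_module S -> t != 0 -> forall s, exists r : R, s = r *: t.
Proof.
move=> [_ simpleS] tn0 s.
case: (simpleS _ (submod_closed_cyclic t)) => [cyc0|cycT].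
  have := cyc0 t; rewrite !inE (negPf tn0) => /asboolP[].
  by exists 1; rewrite scale1r.
by have := cycT s; rewrite !inE => /asboolP.
Qed.

Lemma linear_corestriction (R : comNzRingType) (M N E : lmodType R)
    (i : {linear M -> E}) (g : {linear N -> E}) :
  injective i -> (forall x, exists m, i m = g x) ->
  exists p : {linear N -> M}, forall x, i (p x) = g x.
Proof.
move=> i_inj /choice[p pE].
have p_lin : linear p.
  by move=> c u v; apply: i_inj; rewrite linearP !pE linearP.
pose pL := GRing.isLinear.Build R N M *:%R p p_lin.
pose p' : {linear N -> M} := HB.pack p pL.
by exists p'.
Qed.

(** By essentiality some multiple [(r * a) *: x] is a nonzero element of [i M].
    Then [r * a != 0], so [r *: s0 != 0]; as [S] is simple, [r] is invertible
    modulo [ann s0], hence modulo [ann a], and the multiple can be scaled back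
    to [a *: x]. *)
Lemma scale_in_hull (R : comNzRingType) (M S E : lmodType R)
    (i : {linear M -> E}) (a : R) (s0 : S) :
  essential_embedding i -> simple_module S ->
  (forall r : R, r *: s0 = 0 -> r * a = 0) ->
  forall x : E, exists m, i m = a *: x.
Proof.
move=> [_ essi] simpleS ann_a x.
have [->|axn0] := eqVneq (a *: x) 0; first by exists 0; rewrite linear0.
have [|m] := essi _ (submod_closed_cyclic (a *: x)).
  by exists (a *: x) => //; rewrite inE; apply/asboolP; exists 1; rewrite scale1r.
rewrite inE => /asboolP[r im] imn0.
have rs0n0 : r *: s0 != 0.
  apply: contraNneq imn0 => /ann_a ra0.
  by rewrite im scalerA ra0 scale0r.
have [q s0E] := simple_module_cyclic simpleS rs0n0 s0.
have qraE : q * r * a = a.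
  (* 1 - q * r annihilates s0, hence a. *)
  apply/esym/eqP; rewrite -subr_eq0 -{1}[a]mul1r -mulrBl.
  by rewrite ann_a // scalerBl scale1r -scalerA -s0E subrr.
by exists (q *: m); rewrite linearZ /= im !scalerA mulrA qraE.
Qed.

Theorem corollary3p2 (R : comNzRingType) : kasch R -> strongly_dual_kasch R.
Proof.
move=> kaschR S simpleS E i [injE essi].
have [f f_inj] := kaschR S simpleS.
have [[s0 s0n0] _] := simpleS.
pose a : R := f s0.
have ann_a r : r *: s0 = 0 -> r * a = 0.
  by move=> rs0; rewrite -[r * a](linearZ_LR f) rs0 linear0.
have [i_inj _] := essi.
have [p pE] := linear_corestriction (g := a \*: idfun) i_inj
                 (scale_in_hull essi simpleS ann_a).
have [h hE] := injE _ _ f i f_inj.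
have ph1 : p (h 1) = s0.
  by apply: i_inj; rewrite pE /= -linearZ /= -hE; congr (h _); apply: mulr1.
exists p => s; have [r ->] := simple_module_cyclic simpleS s0n0 s.
by exists (r *: h 1); rewrite linearZ /= ph1.
Qed.
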